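(* For all $n \ge 1$, $$|S_n(132, 4213, 2341)| = F_{n+5} - \binom{n+1}{2} - 2\binom{n+1}{1} - 2.$$ Moreover, the generating function $f(x) = \sum_{n=0}^\infty |S_n(132, 4213, 2341)|\, x^n$ is given by $$f(x) = \frac{x^4 - x^3 - 3x^2 + 3x - 1}{(x^2 + x - 1)(1 - x)^3}.$$
   Context: Permutations of $[n]$ are written in one-line notation, and $S_n$ denotes the set of them. A permutation $\pi\in S_n$ contains $\sigma\in S_m$ if there are indices $i_1<\dots<i_m$ such that for all $a,b$, $\pi(i_a)<\pi(i_b)$ iff $\sigma(a)<\sigma(b)$; otherwise $\pi$ avoids $\sigma$. For a set $R$ of permutations, $S_n(R)$ is the set of $\pi\in S_n$ avoiding every element of $R$; $S_0(R)$ consists of the empty permutation only. $F_n$ denotes the Fibonacci numbers with $F_0=0$, $F_1=F_2=1$, $F_n=F_{n-1}+F_{n-2}$. *)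

(* Defs.v *)
From HB Require Import structures.
From mathcomp Require Import all_boot all_order all_algebra all_fingroup.
Set Implicit Arguments.
Unset Strict Implicit.
Unset Printing Implicit Defensive.
Import Order.TTheory GRing.Theory Num.Theory.

Definition contains (n m : nat) (pi : 'S_n) (sigma : 'S_m) : bool :=
  [exists i : {ffun 'I_m -> 'I_n},
    [forall a : 'I_m, forall b : 'I_m, (a < b) ==> (i a < i b)] &&
    [forall a : 'I_m, forall b : 'I_m,
       (pi (i a) < pi (i b)) == (sigma a < sigma b)]].

Definition pattern := {m : nat & 'S_m}.

Definition avoiders (n : nat) (R : seq pattern) : {set 'S_n} :=
  [set pi : 'S_n | all (fun s : pattern => ~~ contains pi (tagged s)) R].

(* One-line notation uses the values 1..m, whereas 'S_m permutes 0..m-1: the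
   word s denotes the permutation mapping position i to (nth 0 s i).-1. *)
Section OneLine.

Variable s : seq nat.
Hypothesis s_perm : perm_eq s (iota 1 (size s)).

Lemma one_line_range (i : 'I_(size s)) : 0 < nth 0 s i <= size s.
Proof.
have := mem_nth 0 (ltn_ord i).
by rewrite (perm_mem s_perm) mem_iota add1n ltnS.
Qed.

Lemma one_line_bound (i : 'I_(size s)) : (nth 0 s i).-1 < size s.
Proof. by case/andP: (one_line_range i) => s_gt0; rewrite prednK. Qed.

Definition one_line_fun (i : 'I_(size s)) : 'I_(size s) :=
  Ordinal (one_line_bound i).

Lemma one_line_inj : injective one_line_fun.
Proof.
move=> i j /(congr1 val) /= eq_ij; apply/val_inj/eqP => /=.
have s_uniq : uniq s by rewrite (perm_uniq s_perm) iota_uniq.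
rewrite -(nth_uniq 0 (ltn_ord i) (ltn_ord j) s_uniq).
have /andP[i_gt0 _] := one_line_range i; have /andP[j_gt0 _] := one_line_range j.
by rewrite -(prednK i_gt0) -(prednK j_gt0) eq_ij.
Qed.

Definition one_line : pattern :=
  Tagged (fun m => 'S_m) (perm one_line_inj).

End OneLine.

Arguments one_line s s_perm : clear implicits.

Definition p132 : pattern := one_line [:: 1; 3; 2] isT.
Definition p4213 : pattern := one_line [:: 4; 2; 1; 3] isT.
Definition p2341 : pattern := one_line [:: 2; 3; 4; 1] isT.

Fixpoint fib (n : nat) : nat :=
  match n with
  | 0 => 0
  | 1 => 1
  | (m.+1 as k).+1 => fib k + fib m
  end.

Local Open Scope ring_scope.

(* A formal power series is given by its sequence of coefficients; equality of
   power series is =1. *)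
Section PowerSeries.

Variable K : fieldType.

Definition fps := nat -> K.

Definition fps_of_poly (p : {poly K}) : fps := fun n => p`_n.

Definition fps_mul (a b : fps) : fps :=
  fun n => \sum_(i < n.+1) a i * b (n - i)%N.

(* The first n coefficients of 1 / a, from b_0 = 1 / a_0 and
   b_k = - (a_1 b_(k-1) + ... + a_k b_0) / a_0. *)
Fixpoint fps_inv_seq (a : fps) (n : nat) : seq K :=
  if n is k.+1 then
    let b := fps_inv_seq a k in
    rcons b (((k == 0)%N%:R - \sum_(i < k) a i.+1 * b`_(k - i.+1)%N) / a 0%N)
  else [::].

Definition fps_inv (a : fps) : fps := fun n => (fps_inv_seq a n.+1)`_n.

Definition fps_div (a b : fps) : fps := fps_mul a (fps_inv b).

Lemma size_fps_inv_seq (a : fps) n : size (fps_inv_seq a n) = n.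
Proof. by elim: n => //= n IHn; rewrite size_rcons IHn. Qed.

Lemma nth_fps_inv_seq (a : fps) n k :
  (k < n)%N -> (fps_inv_seq a n)`_k = fps_inv a k.
Proof.
elim: n => // n IHn; rewrite ltnS leq_eqVlt => /predU1P[-> //|lt_kn].
by rewrite /= nth_rcons size_fps_inv_seq lt_kn IHn.
Qed.

Lemma fps_mulV (a : fps) :
  a 0%N != 0 -> fps_mul a (fps_inv a) =1 fps_of_poly 1.
Proof.
move=> a0 n; rewrite /fps_mul /fps_of_poly coef1 big_ord_recl subn0.
have -> : fps_inv a n =
    ((n == 0)%N%:R - \sum_(i < n) a i.+1 * fps_inv a (n - i.+1)%N) / a 0%N.
  rewrite {1}/fps_inv /= nth_rcons size_fps_inv_seq ltnn eqxx.
  congr ((_ - _) / _); apply: eq_bigr => i _.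
  by rewrite nth_fps_inv_seq // ltn_subrL /= (leq_ltn_trans _ (ltn_ord i)).
by rewrite mulrC divfK // subrK.
Qed.

End PowerSeries.

(* Main.v *)
(* Write a 132-avoiding permutation of [n] as L n R: every entry of L exceeds
   every entry of R.  It avoids 4213 iff L avoids 4213 and R avoids 213, and it
   avoids 2341 iff L and R do and either R is empty or L is decreasing.  Hence
   a_n = a_(n-1) + \sum_(1 <= k < n) c_k, where c_k counts the permutations of
   [k] avoiding 132, 213 and 2341.  The same decomposition applied to those
   forces L to be increasing, and of length at most 1 unless R is empty, so
   that c_k = 1 + c_(k-1) + c_(k-2) (with c_0 = c_(-1) = 0), that is
   c_k = F_(k+2) - 1. *)
Require Import Defs.
From mathcomp Require Import all_boot all_order all_algebra all_fingroup.
From mathcomp Require Import zify ring lra.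
Import GRing.Theory.

Set Implicit Arguments.
Unset Strict Implicit.
Unset Printing Implicit Defensive.

(** * Permutations as words, and pattern occurrences in words *)

(** Only the relative order of the entries of [p] matters, so a pattern with values from 1 can be
    matched against words with values from 0. *)
Definition occurs (p s : seq nat) : Prop :=
  exists t : seq nat, [/\ subseq t s, size t = size p &
    forall i j, i < size p -> j < size p ->
      (nth 0 t i < nth 0 t j) = (nth 0 p i < nth 0 p j)].

Definition word n (pi : 'S_n) : seq nat := [seq val (pi i) | i <- enum 'I_n].

Lemma word_inj n : injective (@word n).
Proof.
move=> pi rho /eq_in_map eq_w; apply/permP => i; apply: val_inj.
by apply: eq_w; rewrite mem_enum.
Qed.

Lemma word_perm n (pi : 'S_n) : perm_eq (word pi) (iota 0 n).
Proof.
apply: uniq_perm; rewrite ?iota_uniq //.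
  by rewrite map_inj_uniq ?enum_uniq // => i j /val_inj /perm_inj.
move=> x; rewrite mem_iota add0n /=; apply/mapP/idP => [[i _ ->]|lt_xn].
  exact: ltn_ord.
by exists (pi^-1%g (Ordinal lt_xn)); rewrite ?mem_enum // permKV.
Qed.

Lemma word_surj n s : perm_eq s (iota 0 n) -> exists pi : 'S_n, word pi = s.
Proof.
move=> s_perm; have sz_s : size s = n by rewrite (perm_size s_perm) size_iota.
have s_uniq : uniq s by rewrite (perm_uniq s_perm) iota_uniq.
have bnd (i : 'I_n) : nth 0 s i < n.
  have : nth 0 s i \in s by rewrite mem_nth ?sz_s.
  by rewrite (perm_mem s_perm) mem_iota.
have inj : injective (fun i : 'I_n => Ordinal (bnd i)).
  move=> i j [] /eqP; rewrite nth_uniq ?sz_s // => /eqP.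
  exact: val_inj.
exists (perm inj); apply: (@eq_from_nth _ 0).
  by rewrite size_map size_enum_ord.
rewrite size_map size_enum_ord => i lt_in.
rewrite (nth_map (Ordinal lt_in)) ?size_enum_ord // permE /=.
by rewrite nth_enum_ord.
Qed.

(** A strictly increasing word is determined by its set of entries, so [u] is the enumeration
    filtered by membership in [u]. *)
Lemma subseq_enum_ord n (u : seq 'I_n) :
  subseq u (enum 'I_n) = sorted ltn (map val u).
Proof.
apply/idP/idP => [sub_u|srt_u].
  apply: (subseq_sorted ltn_trans (map_subseq val sub_u)).
  by rewrite val_enum_ord iota_ltn_sorted.
suff <- : [seq i <- enum 'I_n | i \in u] = u by apply: filter_subseq.
apply: (inj_map val_inj); apply: (irr_sorted_eq ltn_trans ltnn) => //.
  apply: (subseq_sorted ltn_trans (map_subseq val (filter_subseq _ _))).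
  by rewrite val_enum_ord iota_ltn_sorted.
by apply: eq_mem_map => i; rewrite mem_filter mem_enum andbT.
Qed.

(** Increasing choices of indices are subsequences of [enum 'I_n]; mapping [pi] over them yields
    subsequences of [word pi]. *)
Lemma contains_one_line n (pi : 'S_n) p (p_perm : perm_eq p (iota 1 (size p))) :
  contains pi (tagged (one_line p p_perm)) <-> occurs p (word pi).
Proof.
have lt_sigma (a b : 'I_(size p)) :
    (tagged (one_line p p_perm) a < tagged (one_line p p_perm) b)
      = (nth 0 p a < nth 0 p b).
  rewrite /= !permE /=.
  have /andP[a_gt0 _] := one_line_range p_perm a.
  have /andP[b_gt0 _] := one_line_range p_perm b; lia.
split=> [/existsP[/= i /andP[/forallP inc_i /forallP iso_i]]|].
  exists [seq val (pi k) | k <- [seq i a | a <- enum 'I_(size p)]]; split.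
  - apply: map_subseq; rewrite subseq_enum_ord -map_comp.
    have : sorted ltn (map val (enum 'I_(size p))).
      by rewrite val_enum_ord iota_ltn_sorted.
    rewrite !sorted_map; apply: sub_sorted => a b /= lt_ab.
    by have /forallP/(_ b)/implyP := inc_i a; apply.
  - by rewrite 2!size_map size_enum_ord.
  - move=> a b lt_a lt_b.
    have /forallP/(_ (Ordinal lt_b))/eqP := iso_i (Ordinal lt_a).
    rewrite lt_sigma /= => <-; rewrite -map_comp.
    rewrite (nth_map (Ordinal lt_a)) ?size_enum_ord //.
    rewrite (nth_map (Ordinal lt_a)) ?size_enum_ord //.
    by rewrite !(@nth_ord_enum _ _ (Ordinal _)).
(* The mask that selects the occurrence in [word pi] also selects its positions [u]. *)
case=> _ [/subseqP[m _ ->]]; rewrite -map_mask; set u := mask m _.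
have srt_u : sorted ltn (map val u) by rewrite -subseq_enum_ord mask_subseq.
rewrite size_map => sz_u iso_u.
have sz_u' : size u == size p by apply/eqP.
have nth_u (f : 'I_n -> nat) (a : 'I_(size p)) :
    nth 0 (map f u) a = f (tnth (Tuple sz_u') a).
  have x0 := tnth (Tuple sz_u') a.
  by rewrite (tnth_nth x0) (nth_map x0) ?sz_u.
apply/existsP; exists [ffun a => tnth (Tuple sz_u') a]; apply/andP; split.
  apply/forallP => a; apply/forallP => b; apply/implyP => lt_ab; rewrite !ffunE.
  have := sorted_ltn_nth ltn_trans 0 srt_u.
  move=> /(_ a b); rewrite !inE size_map sz_u !ltn_ord => /(_ isT isT lt_ab).
  by rewrite !nth_u.
apply/forallP => a; apply/forallP => b; rewrite lt_sigma !ffunE -iso_u //.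
by rewrite !nth_u.
Qed.

(** * The patterns as inequalities on subsequences *)

(** A chain of strict inequalities through all entries fixes their relative order, and keeps the
    later case analyses within reach of [lia]. *)
Definition av12 s := forall a b, subseq [:: a; b] s -> ~ a < b.
Definition av21 s := forall a b, subseq [:: a; b] s -> ~ b < a.
Definition av132 s := forall a b c, subseq [:: a; b; c] s -> ~ a < c < b.
Definition av213 s := forall a b c, subseq [:: a; b; c] s -> ~ (b < a < c).
Definition av4213 s :=
  forall a b c d, subseq [:: a; b; c; d] s -> ~ [&& c < b, b < d & d < a].
Definition av2341 s :=
  forall a b c d, subseq [:: a; b; c; d] s -> ~ [&& d < a, a < b & b < c].

Lemma not_occurs132 s : ~ occurs [:: 1; 3; 2] s <-> av132 s.
Proof.
split=> [noc a b c sub_t lt_t|av [[|a [|b [|c [|? ?]]]] [sub_t // _ iso_t]]].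
  apply: noc; exists [:: a; b; c]; split=> //.
  move=> [|[|[|i]]] [|[|[|j]]] //= _ _; lia.
by apply: (av a b c sub_t); rewrite (iso_t 0 2) // (iso_t 2 1).
Qed.

Lemma not_occurs4213 s : ~ occurs [:: 4; 2; 1; 3] s <-> av4213 s.
Proof.
split=> [noc a b c d sub_t lt_t|].
  apply: noc; exists [:: a; b; c; d]; split=> //.
  move=> [|[|[|[|i]]]] [|[|[|[|j]]]] //= _ _; lia.
move=> av [[|a [|b [|c [|d [|? ?]]]]] [sub_t // _ iso_t]].
by apply: (av a b c d sub_t); rewrite (iso_t 2 1) // (iso_t 1 3) // (iso_t 3 0).
Qed.

Lemma not_occurs2341 s : ~ occurs [:: 2; 3; 4; 1] s <-> av2341 s.
Proof.
split=> [noc a b c d sub_t lt_t|].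
  apply: noc; exists [:: a; b; c; d]; split=> //.
  move=> [|[|[|[|i]]]] [|[|[|[|j]]]] //= _ _; lia.
move=> av [[|a [|b [|c [|d [|? ?]]]]] [sub_t // _ iso_t]].
by apply: (av a b c d sub_t); rewrite (iso_t 3 0) // (iso_t 0 1) // (iso_t 1 2).
Qed.

Lemma mem_avoiders n (pi : 'S_n) :
  pi \in avoiders n [:: p132; p4213; p2341] <->
  [/\ av132 (word pi), av4213 (word pi) & av2341 (word pi)].
Proof.
have c132 := @contains_one_line n pi [:: 1; 3; 2] isT.
have c4213 := @contains_one_line n pi [:: 4; 2; 1; 3] isT.
have c2341 := @contains_one_line n pi [:: 2; 3; 4; 1] isT.
rewrite inE /= andbT; split=> [/and3P[/negP n1 /negP n2 /negP n3]|[]].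
  by split; [apply/not_occurs132 => /c132 | apply/not_occurs4213 => /c4213
            | apply/not_occurs2341 => /c2341].
move=> /not_occurs132 n1 /not_occurs4213 n2 /not_occurs2341 n3.
by apply/and3P; split; apply/negP;
  [move=> /c132 | move=> /c4213 | move=> /c2341].
Qed.

(** * Splitting a word at its maximum *)

Lemma subseq_cat_split (T : eqType) (t s1 s2 : seq T) :
  subseq t (s1 ++ s2) ->
  exists t1 t2, [/\ t = t1 ++ t2, subseq t1 s1 & subseq t2 s2].
Proof.
case/subseqP=> m sz_m ->; exists (mask (take (size s1) m) s1).
exists (mask (drop (size s1) m) s2); split; rewrite ?mask_subseq //.
rewrite -{1}(cat_take_drop (size s1) m) mask_cat // size_takel // sz_m size_cat.
exact: leq_addr.
Qed.

Definition max_split n (L R : seq nat) :=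
  [/\ all (fun x => x < n) L, all (fun x => x < n) R
    & allrel (fun x y => y < x) L R].

Section MaxSplit.

Variables (n : nat) (L R : seq nat).
Hypothesis splitLR : max_split n L R.

(** An occurrence inherits the split shape, with or without [n], so each avoidance criterion below
    reduces to finitely many cut points. *)
Lemma subseq_max_split t : subseq t (L ++ n :: R) ->
  exists t1 t2, [/\ t = t1 ++ t2 \/ t = t1 ++ n :: t2,
    subseq t1 L, subseq t2 R & max_split n t1 t2].
Proof.
have [ltL ltR gtLR] := splitLR.
case/subseq_cat_split => t1 [t2 [-> sub1 sub2]].
have sub_split t3 : subseq t3 R -> max_split n t1 t3.
  move=> sub3; split.
  - by apply/allP => x /(mem_subseq sub1) /(allP ltL).
  - by apply/allP => x /(mem_subseq sub3) /(allP ltR).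
  - apply/allrelP => x y x_t1 y_t3; apply: (allrelP gtLR).
      exact: mem_subseq sub1 _ x_t1.
    exact: mem_subseq sub3 _ y_t3.
case: t2 sub2 => [|x t2] /=.
  by move=> _; exists t1, [::]; rewrite sub1 sub0seq; split=> //;
    [left | exact: sub_split (sub0seq _)].
case: eqP => [-> sub2|_ sub2]; [exists t1, t2 | exists t1, (x :: t2)];
  by split=> //; by [left | right | apply: sub_split].
Qed.

Lemma subseq_l_max t : subseq t L -> subseq t (L ++ n :: R).
Proof. by move=> sub; apply: subseq_trans sub (prefix_subseq _ _). Qed.

Lemma subseq_cons_max t : subseq t R -> subseq (n :: t) (L ++ n :: R).
Proof.
by move=> sub; apply: subseq_trans (suffix_subseq _ _); rewrite /= eqxx.
Qed.

Lemma subseq_r_max t : subseq t R -> subseq t (L ++ n :: R).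
Proof.
move=> /subseq_cons_max; apply: subseq_trans; exact: subseq_cons.
Qed.

(** Runs through the cut points of an occurrence; [lia] discards those that contradict [n] being
    maximal or [L] lying above [R]. *)
Ltac split_occurrence sub :=
  let t1 := fresh "t1" in let t2 := fresh "t2" in
  let E := fresh "E" in let gt := fresh "gt" in
  have [t1 [t2 [[E|E] ? ? [? ? gt]]]] := subseq_max_split sub;
  rewrite /allrel in gt;
  destruct t1 as [|? [|? [|? [|? [|? ?]]]]];
  simpl in E; try discriminate E;
  (first [subst t2 | injection E; clear E; intros; subst]) => //;
  simpl in *; try lia.

(** The leading 1 is smallest, so an occurrence starting in [L] cannot reach [R]; and [n] could only
    be the 3, with the 1 in [L] below the 2 in [R], which is impossible. *)
Lemma av132_max_split : av132 (L ++ n :: R) <-> av132 L /\ av132 R.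
Proof.
split=> [av|[avL avR] a b c sub].
  by split=> a b c sub; apply: av; [apply: subseq_l_max|apply: subseq_r_max].
by split_occurrence sub; [apply: avR | apply: avL].
Qed.

Lemma all_lt_max_split t : subseq t L -> all (fun x => x < n) t.
Proof.
have [/allP ltL _ _] := splitLR.
by move=> sub; apply/allP => x /(mem_subseq sub)/ltL.
Qed.

(** A 21 in [L] followed by [n] is a 213. Conversely, an occurrence not inside [R] has its first two
    entries in [L]. *)
Lemma av213_max_split : av213 (L ++ n :: R) <-> av21 L /\ av213 R.
Proof.
split=> [av|[avL avR] a b c sub].
  split=> [a b sub|a b c sub]; last by apply: av; apply: subseq_r_max.
  have /= lt_ab := all_lt_max_split sub; move=> lt_ba.
  apply: (av a b n); last lia.
  by apply: (@cat_subseq _ [:: a; b] [:: n]); rewrite // sub1seq mem_head.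
split_occurrence sub; first exact: avR.
- move=> lt; apply: (avL s s0); last by case/andP: lt.
  by apply: subseq_trans (prefix_subseq [:: s; s0] [:: s1]) _.
- by move=> /andP[lt _]; apply: (avL s s0).
Qed.

(** [n] followed by a 213 in [R] is a 4213. Conversely, an occurrence not inside [L] has its last
    three entries in [R]. *)
Lemma av4213_max_split : av4213 (L ++ n :: R) <-> av4213 L /\ av213 R.
Proof.
split=> [av|[avL avR] a b c d sub].
  split=> [a b c d sub|a b c sub]; first by apply: av; apply: subseq_l_max.
  have [_ /allP ltR _] := splitLR => lt_abc.
  apply: (av n a b c); first exact: subseq_cons_max.
  have: c < n by apply/ltR/(mem_subseq sub); rewrite !inE eqxx !orbT.
  lia.
split_occurrence sub; last 2 first.
- exact: avL.
- by move=> lt; apply: (avR b c d) => //; lia.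
- move=> lt; apply: (avR b c d); last lia.
  by apply: subseq_trans (subseq_cons _ a) _.
- by move=> lt; apply: (avR b c d) => //; lia.
Qed.

(** An increasing pair in [L], then [n], then any entry of [R] is a 2341. Conversely, an occurrence
    inside neither part starts with such a pair and ends in [R]. *)
Lemma av2341_max_split : av2341 (L ++ n :: R) <->
  [/\ av2341 L, av2341 R & R = [::] \/ av12 L].
Proof.
split=> [av|[avL avR nilR] a b c d sub].
  split=> [a b c d sub|a b c d sub|]; try apply: av.
  - exact: subseq_l_max.
  - exact: subseq_r_max.
  case: R splitLR av => [|y R'] split' av; [by left|right=> a b sub lt_ab].
  have [/allP ltL _ /allrelP gtLR] := split'.
  have a_L : a \in L by apply: (mem_subseq sub); rewrite mem_head.
  have b_L : b \in L by apply: (mem_subseq sub); rewrite !inE eqxx orbT.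
  apply: (av a b n y).
    apply: (@cat_subseq _ [:: a; b] [:: n; y]) => //=.
    by rewrite !eqxx sub0seq.
  have := ltL _ b_L; have := gtLR _ _ a_L (mem_head _ _); lia.
have av12L y : y \in R -> av12 L by case: nilR => [->|].
split_occurrence sub; first exact: avR.
- move=> lt; apply: (av12L d _ s s0); last lia; first by rewrite -sub1seq.
  by apply: subseq_trans (prefix_subseq [:: s; s0] [:: s1]) _.
- exact: avL.
- by move=> lt; apply: (av12L d _ s s0); rewrite -?sub1seq //; lia.
Qed.

End MaxSplit.

(** * The shape of 132-avoiding permutations *)

Lemma perm_max n L R :
  perm_eq (L ++ n :: R) (iota 0 n.+1) = perm_eq (L ++ R) (iota 0 n).
Proof.
rewrite -addn1 iotaD add0n.
apply/seq.permP/seq.permP => eq_count a;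
  by have := eq_count a; rewrite !count_cat /=; lia.
Qed.

(** An entry [x] of [L] below an entry [y] of [R] would make [x n y] a 132. *)
Lemma perm_max_split n s : perm_eq s (iota 0 n.+1) -> av132 s ->
  exists L R, [/\ s = L ++ n :: R, perm_eq (L ++ R) (iota 0 n) & max_split n L R].
Proof.
move=> s_perm av.
have n_s : n \in s by rewrite (perm_mem s_perm) mem_iota add0n ltnSn.
case/splitPr: n_s s_perm av => L R s_perm av; exists L, R.
have LR_perm : perm_eq (L ++ R) (iota 0 n) by rewrite -perm_max.
have ltLR x : x \in L ++ R -> x < n by rewrite (perm_mem LR_perm) mem_iota.
have LR_uniq : uniq (L ++ R) by rewrite (perm_uniq LR_perm) iota_uniq.
split=> //; split.
- by apply/allP => x x_L; apply: ltLR; rewrite mem_cat x_L.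
- by apply/allP => x x_R; apply: ltLR; rewrite mem_cat x_R orbT.
apply/allrelP => x y x_L y_R.
have := av x n y (@cat_subseq _ [:: x] [:: n; y] L (n :: R) _ _).
rewrite /= eqxx !sub1seq => /(_ x_L y_R).
have : y < n by apply: ltLR; rewrite mem_cat y_R orbT.
suff : x != y by lia.
move: LR_uniq; rewrite cat_uniq => /and3P[_ /hasPn/(_ _ y_R) /= y_L _].
by apply: contraNneq y_L => <-.
Qed.

(** Sorted [R] followed by sorted [L] is increasing, hence equals [iota 0 n]; cutting at [size R]
    identifies both value sets. *)
Lemma perm_cat_gt n L R : perm_eq (L ++ R) (iota 0 n) ->
  allrel (fun x y => y < x) L R ->
  perm_eq L (iota (size R) (n - size R)) /\ perm_eq R (iota 0 (size R)).
Proof.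
move=> LR_perm gtLR.
have sz : size L + size R = n by rewrite -size_cat (perm_size LR_perm) size_iota.
have : sort leq R ++ sort leq L = iota 0 (size R) ++ iota (size R) (n - size R).
  rewrite -{3}[size R]add0n -iotaD.
  have -> : size R + (n - size R) = n by lia.
  apply: (sorted_eq leq_trans anti_leq); last 2 first.
  - exact: iota_sorted.
  - apply/seq.permP => a; have /seq.permP/(_ a) <- := LR_perm.
    by rewrite !count_cat !count_sort addnC.
  rewrite sorted_pairwise; last exact: leq_trans.
  rewrite pairwise_cat -!sorted_pairwise; try exact: leq_trans.
  rewrite !sort_sorted ?andbT; try exact: leq_total.
  apply/allrelP => x y; rewrite !mem_sort => x_R y_L.
  by apply: ltnW; apply: (allrelP gtLR).
move/eqP; rewrite eqseq_cat ?size_sort ?size_iota // => /andP[/eqP <- /eqP <-].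
by rewrite !(perm_sym _ (sort _ _)) !perm_sort.
Qed.

(** * Monotone words and recursive lists of the avoiders *)

Lemma av21_sorted s : uniq s -> av21 s -> sorted ltn s.
Proof.
move=> s_uniq av; rewrite sorted_pairwise; last exact: ltn_trans.
elim: s s_uniq av => //= x s IHs /andP[x_s s_uniq] av; apply/andP; split.
  apply/allP => y y_s; have := av x y; rewrite /= eqxx sub1seq => /(_ y_s).
  by have : x != y by [apply: contraNneq x_s => ->]; lia.
by apply: IHs => // a b sub; apply: av; apply: subseq_trans (subseq_cons _ _).
Qed.

Lemma av12_sorted s : uniq s -> av12 s -> sorted ltn (rev s).
Proof.
move=> s_uniq av; apply: av21_sorted; rewrite ?rev_uniq // => a b.
by rewrite -subseq_rev revK => /av.
Qed.

Lemma sorted_perm_iota s m k :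
  sorted ltn s -> perm_eq s (iota m k) -> s = iota m k.
Proof.
move=> srt /perm_mem; exact: (irr_sorted_eq ltn_trans ltnn) (iota_ltn_sorted _ _).
Qed.

(* The nonempty words on 0, ..., k-1 avoiding 132, 213 and 2341: the possible
   nonempty right parts R.  Excluding the empty word makes [inner_words 0]
   empty, so that no boundary case arises in [outer_words]. *)
Fixpoint inner_words k : seq (seq nat) :=
  if k is k'.+1 then
    iota 0 k :: [seq k' :: r | r <- inner_words k'] ++
    (if k' is k''.+1 then [seq [:: k'', k' & r] | r <- inner_words k''] else [::])
  else [::].

Lemma inner_wordsS k : inner_words k.+1 =
  iota 0 k.+1 :: [seq k :: r | r <- inner_words k] ++
  (if k is k'.+1 then [seq [:: k', k & r] | r <- inner_words k'] else [::]).
Proof. by []. Qed.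

(** The first list has [R] empty and [L] arbitrary. In the second, [R] is nonempty on the [k]
    smallest values, which forces [L] to be decreasing on the others. *)
Fixpoint outer_words n : seq (seq nat) :=
  if n is n'.+1 then
    [seq rcons s n' | s <- outer_words n'] ++
    [seq rev (iota k (n' - k)) ++ n' :: r | k <- iota 0 n, r <- inner_words k]
  else [:: [::]].

Lemma outer_wordsS n : outer_words n.+1 =
  [seq rcons s n | s <- outer_words n] ++
  [seq rev (iota k (n - k)) ++ n :: r | k <- iota 0 n.+1, r <- inner_words k].
Proof. by []. Qed.

Lemma sorted_avoids s : sorted ltn s -> [/\ av21 s, av132 s, av213 s & av2341 s].
Proof.
move=> srt; have sub_srt t : subseq t s -> sorted ltn t.
  by move=> sub; apply: (subseq_sorted ltn_trans sub srt).
by split=> [a b|a b c|a b c|a b c d] /sub_srt /=; lia.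
Qed.

Lemma rev_sorted_avoids s :
  sorted ltn (rev s) -> [/\ av12 s, av132 s, av4213 s & av2341 s].
Proof.
move=> srt; have sub_srt t : subseq t s -> sorted ltn (rev t).
  by move=> sub; apply: (subseq_sorted ltn_trans _ srt); rewrite subseq_rev.
by split=> [a b|a b c|a b c d|a b c d] /sub_srt; rewrite /rev /=; lia.
Qed.

Lemma perm_cat_gt_iota n L R k : k <= n ->
  perm_eq L (iota k (n - k)) -> perm_eq R (iota 0 k) ->
  perm_eq (L ++ R) (iota 0 n) /\ max_split n L R.
Proof.
move=> le_kn L_perm R_perm; split.
  rewrite perm_catC -(subnKC le_kn) iotaD add0n; exact: perm_cat.
split.
- by apply/allP => x; rewrite (perm_mem L_perm) mem_iota; lia.
- by apply/allP => x; rewrite (perm_mem R_perm) mem_iota; lia.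
- by apply/allrelP => x y; rewrite (perm_mem L_perm) (perm_mem R_perm) !mem_iota;
  lia.
Qed.

(** The three pieces of the list are [R] empty with [L] increasing, [L] empty, and [L] a singleton.
    Once [R] is nonempty, [L] avoids both 12 and 21, so it has at most one entry. *)
Lemma mem_inner_words k s : s \in inner_words k <->
  [/\ s != [::], perm_eq s (iota 0 k), av132 s, av213 s & av2341 s].
Proof.
elim/ltn_ind: k s => -[_ s|k IHk s].
  by split=> // -[nz /perm_size /size0nil s0]; rewrite s0 in nz.
split.
  rewrite inner_wordsS inE mem_cat => /or3P[/eqP ->||].
  - by have [_ ? ? ?] := sorted_avoids (iota_ltn_sorted 0 k.+1); split.
  - case/mapP=> r /(IHk k (ltnSn k))[nz r_perm av1 av2 av3] ->.
    have [|||LR_perm split] := @perm_cat_gt_iota k [::] r k => //.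
      by rewrite subnn.
    split=> //; first exact: (etrans (perm_max _ _ _) LR_perm).
    + exact/(av132_max_split split).
    + exact/(av213_max_split split).
    + by apply/(av2341_max_split split); split=> //; right.
  - case: k IHk => // k IHk /mapP[r /(IHk k)[|nz r_perm av1 av2 av3 ->]]; first lia.
    have [|||LR_perm split] := @perm_cat_gt_iota k.+1 [:: k] r k => //.
      by rewrite subSnn.
    have [av21k av132k av213k av2341k] := @sorted_avoids [:: k] isT.
    have [av12k _ _ _] := @rev_sorted_avoids [:: k] isT.
    split=> //; first exact: (etrans (perm_max _ _ _) LR_perm).
    + exact/(av132_max_split split).
    + exact/(av213_max_split split).
    + by apply/(av2341_max_split split); split=> //; right.
case=> nz s_perm av1 av2 av3.
have [L [R [def_s LR_perm split]]] := perm_max_split s_perm av1.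
subst s; have [_ _ gtLR] := split.
have [L_perm R_perm] := perm_cat_gt LR_perm gtLR.
have L_uniq : uniq L by rewrite (perm_uniq L_perm) iota_uniq.
have [_ av1R] := (av132_max_split split).1 av1.
have [av21L av2R] := (av213_max_split split).1 av2.
have [_ av3R nilR] := (av2341_max_split split).1 av3.
have srtL := av21_sorted L_uniq av21L.
rewrite inner_wordsS inE mem_cat; apply/or3P.
have [R0|nzR] := eqVneq R [::].
  apply: Or31; move: L_perm; rewrite R0 subn0 => /(sorted_perm_iota srtL) ->.
  by rewrite -[k.+1]addn1 iotaD.
case: nilR => [R0|av12L]; first by rewrite R0 in nzR.
have szR : size R <= k.
  by have := perm_size LR_perm; rewrite size_cat size_iota => <-; apply: leq_addl.
case: L L_uniq av21L av12L L_perm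
  {LR_perm split gtLR nz s_perm av1 av2 av3 srtL} =>
  [|x [|y L]] L_uniq av21L av12L L_perm.
- apply: Or32; apply/mapP; exists R => //; apply/IHk => //; split=> //.
  have := perm_size L_perm; rewrite size_iota /= => szk.
  by have -> : k = size R by lia.
- have := perm_size L_perm; rewrite size_iota /= => szk.
  have def_k : k = (size R).+1 by lia.
  apply: Or33; rewrite def_k; apply/mapP; exists R.
    by apply/IHk; rewrite ?def_k.
  move: L_perm; rewrite def_k subSnn /= => /perm_mem/(_ x); rewrite !inE eqxx.
  by move/esym/eqP => ->.
- have sub : subseq [:: x; y] [:: x, y & L] by rewrite /= !eqxx sub0seq.
  have := av21L x y sub; have := av12L x y sub.
  by move: L_uniq; rewrite /= inE; case: (ltngtP x y).
Qed.

(** The induction hypothesis serves the case of empty [R]. Otherwise [L] is decreasing, hence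
    determined by its values, and [R] is an inner word. *)
Lemma mem_outer_words n s : s \in outer_words n <->
  [/\ perm_eq s (iota 0 n), av132 s, av4213 s & av2341 s].
Proof.
elim: n s => [|n IHn] s.
  rewrite inE; split=> [/eqP ->|[/perm_size/size0nil -> //]].
  by have [_ ? ? ?] := @rev_sorted_avoids [::] isT.
split.
  rewrite outer_wordsS mem_cat => /orP[/mapP[t /IHn[t_perm av1 av2 av3] ->]|].
    have [|||LR_perm split] := @perm_cat_gt_iota n t [::] 0; rewrite ?subn0 //.
    rewrite -cats1; split=> //.
    - exact: (etrans (perm_max _ _ _) LR_perm).
    - exact/(av132_max_split split).
    - exact/(av4213_max_split split).
    - by apply/(av2341_max_split split); split=> //; left.
  case/allpairsPdep=> k [r [k_n /mem_inner_words[nz r_perm av1 av2 av3] ->]].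
  have le_kn : k <= n by move: k_n; rewrite mem_iota; lia.
  set L := rev _.
  have srtL : sorted ltn (rev L) by rewrite revK iota_ltn_sorted.
  have [av12L av132L av4213L av2341L] := rev_sorted_avoids srtL.
  have [|||LR_perm split] := @perm_cat_gt_iota n L r k => //.
    by rewrite perm_rev.
  split=> //.
  - exact: (etrans (perm_max _ _ _) LR_perm).
  - exact/(av132_max_split split).
  - exact/(av4213_max_split split).
  - by apply/(av2341_max_split split); split=> //; right.
case=> s_perm av1 av2 av3.
have [L [R [def_s LR_perm split]]] := perm_max_split s_perm av1.
subst s; have [_ _ gtLR] := split.
have [L_perm R_perm] := perm_cat_gt LR_perm gtLR.
have L_uniq : uniq L by rewrite (perm_uniq L_perm) iota_uniq.
have [av1L av1R] := (av132_max_split split).1 av1.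
have [av2L av2R] := (av4213_max_split split).1 av2.
have [av3L av3R nilR] := (av2341_max_split split).1 av3.
rewrite outer_wordsS mem_cat; apply/orP.
have [R0|nzR] := eqVneq R [::].
  left; apply/mapP; exists L; last by rewrite R0 cats1.
  by apply/IHn; split=> //; move: LR_perm; rewrite R0 cats0.
right; case: nilR => [R0|av12L]; first by rewrite R0 in nzR.
apply/allpairsPdep; exists (size R), R; split.
- have := perm_size LR_perm; rewrite size_cat mem_iota size_iota => <-.
  by rewrite add0n ltnS leq_addl.
- exact/mem_inner_words.
- congr (_ ++ _); rewrite -[L]revK; congr rev.
  by apply: (sorted_perm_iota (av12_sorted L_uniq av12L)); rewrite perm_rev.
Qed.

(** * Counting the listed words *)

Lemma inner_words_uniq k : uniq (inner_words k).
Proof.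
elim/ltn_ind: k => -[//|k IHk]; rewrite inner_wordsS cons_uniq cat_uniq.
apply/and4P; split.
- rewrite mem_cat; apply/norP; split.
    by case: k {IHk} => //= k; apply/mapP => -[].
  case: k {IHk} => // k; apply/mapP => -[r /mem_inner_words[nz _ _ _ _]] /=.
  (* First entries differ unless [k] is 0; then both words start with 0, 1 and [r] would be
     empty. *)
  by case: k => //= -[] r0; rewrite -r0 in nz.
- by rewrite map_inj_uniq ?IHk // => r r' [].
- case: k {IHk} => // k; apply/hasPn => _ /mapP[r _ ->].
  by apply/mapP => -[r' _ []]; lia.
- by case: k IHk => // k IHk; rewrite map_inj_uniq ?IHk // => r r' [].
Qed.

(** Words of the first list end in [n], those of the second in an entry of the nonempty [r]. Within
    the second, the position [n - k] of [n] reveals [k]. *)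
Lemma outer_words_uniq n : uniq (outer_words n).
Proof.
elim: n => // n IHn; rewrite outer_wordsS cat_uniq; apply/and3P; split.
- by rewrite map_inj_uniq //; exact: rcons_injl.
- apply/hasPn => _ /allpairsPdep[k [r [k_n /mem_inner_words[nz r_perm _ _ _] ->]]].
  apply/mapP => -[t _ /(congr1 (last 0))]; rewrite last_rcons last_cat /=.
  case: r nz r_perm => // x r _ r_perm /= eq_n.
  have : last x r \in x :: r by rewrite mem_last.
  by rewrite (perm_mem r_perm) eq_n mem_iota; move: k_n; rewrite mem_iota; lia.
apply: allpairs_uniq_dep; first exact: iota_uniq.
  by move=> k _; apply: inner_words_uniq.
move=> _ _ /allpairsPdep[k [r [k_n _ ->]]] /allpairsPdep[k' [r' [k'_n _ ->]]] /=.
move: k_n k'_n; rewrite !mem_iota !add0n /= !ltnS => le_kn le_k'n eq_w.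
have idx j t : j <= n -> index n (rev (iota j (n - j)) ++ n :: t) = n - j.
  move=> le_jn; rewrite index_cat mem_rev mem_iota /= eqxx size_rev size_iota.
  by rewrite subnKC // ltnn andbF addn0.
have def_k : k' = k by move/(congr1 (index n)): eq_w; rewrite !idx //; lia.
subst k'; move/eqP: eq_w; rewrite eqseq_cat // eqxx /= => /eqP[->] //.
Qed.

Lemma card_avoiders n :
  #|avoiders n [:: p132; p4213; p2341]| = size (outer_words n).
Proof.
rewrite cardE -(size_map (@word n)); apply/perm_size/uniq_perm.
- by rewrite map_inj_uniq ?enum_uniq //; apply: word_inj.
- exact: outer_words_uniq.
move=> s; apply/mapP/idP => [[pi]|/mem_outer_words[s_perm av1 av2 av3]].
  rewrite mem_enum => /mem_avoiders[av1 av2 av3] ->.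
  by apply/mem_outer_words; rewrite word_perm.
have [pi def_s] := word_surj s_perm; subst s.
by exists pi; rewrite ?mem_enum //; apply/mem_avoiders.
Qed.

Lemma fibSS n : fib n.+2 = fib n.+1 + fib n.
Proof. by []. Qed.

(** Adding 1 turns c_k = 1 + c_(k-1) + c_(k-2) into the Fibonacci recurrence. *)
Lemma size_inner_words k : (size (inner_words k)).+1 = fib k.+2.
Proof.
elim/ltn_ind: k => -[//|[//|k] IHk].
rewrite fibSS -(IHk k) // -(IHk k.+1) // (inner_wordsS k.+1).
rewrite /= size_cat !size_map; lia.
Qed.

Lemma sum_fib n : (\sum_(0 <= k < n) fib k.+2).+2 = fib n.+3.
Proof.
elim: n => [|n IHn]; first by rewrite big_geq.
by rewrite big_nat_recr // (fibSS n.+2) -IHn !addSn.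
Qed.

(** The closed formula with its subtractions moved across to stay in [nat]; here 2n + 4 is 2(n+1) +
    2. *)
Lemma size_outer_words n :
  size (outer_words n) + 'C(n.+1, 2) + n.*2 + 4 = fib n.+4.+1.
Proof.
elim: n => [//|n IHn].
rewrite outer_wordsS size_cat size_map size_allpairs_dep.
(* Summing c_k = F_(k+2) - 1 over k <= n gives F_(n+4) - 2 - (n+1). *)
have : sumn [seq size (inner_words x) | x <- iota 0 n.+1] + n.+3 = fib n.+4.
  rewrite -sum_fib sumnE big_map -{1}(subn0 n.+1) -/(index_iota 0 n.+1).
  under [in RHS]eq_bigr do rewrite -size_inner_words -addn1.
  by rewrite big_split /= sum_nat_const_nat subn0; lia.
rewrite binS bin1 (fibSS n.+4) -IHn; lia.
Qed.

(** * Division of formal power series *)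

Local Open Scope ring_scope.

Section FpsDivision.

Variable K : fieldType.
Implicit Types a b c : fps K.

Lemma eq_fps_mul a a' b b' : a =1 a' -> b =1 b' -> fps_mul a b =1 fps_mul a' b'.
Proof. by move=> ea eb n; apply: eq_bigr => i _; rewrite ea eb. Qed.

(* Associativity is inherited from polynomials, since the coefficient of index
   [m <= n] of a product only depends on the truncations at order [n]. *)
Lemma coef_mul_trunc a b n m : (m <= n)%N ->
  ((\poly_(i < n.+1) a i) * (\poly_(i < n.+1) b i))`_m = fps_mul a b m.
Proof.
move=> le_mn; rewrite coefM; apply: eq_bigr => i _; have lt_im := ltn_ord i.
by rewrite !coef_poly !ifT //; lia.
Qed.

Lemma fps_mulA a b c : fps_mul a (fps_mul b c) =1 fps_mul (fps_mul a b) c.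
Proof.
move=> n; pose T a := \poly_(i < n.+1) a i.
transitivity ((T a * (T b * T c))`_n); last first.
  rewrite mulrA coefM; apply: eq_bigr => i _; have lt_in := ltn_ord i.
  by rewrite coef_mul_trunc // coef_poly ifT //; lia.
rewrite coefM; apply: eq_bigr => i _; have lt_in := ltn_ord i.
by rewrite coef_mul_trunc ?coef_poly ?ifT //; lia.
Qed.

Lemma fps_mul1 a : fps_mul a (fps_of_poly 1) =1 a.
Proof.
move=> n; rewrite /fps_mul big_ord_recr /= subnn /fps_of_poly coef1 mulr1.
rewrite big1 ?add0r // => i _; rewrite coef1 subn_eq0 leqNgt ltn_ord.
by rewrite mulr0.
Qed.

(** c = c (b b^-1) = (c b) b^-1 = a b^-1. This reduces the generating function to a product with the
    denominator. *)
Lemma fps_divP a b c : b 0%N != 0 -> fps_mul c b =1 a -> c =1 fps_div a b.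
Proof.
move=> b0 eq_a n; rewrite -[LHS]fps_mul1.
rewrite -(eq_fps_mul (frefl c) (fps_mulV b0)) fps_mulA.
by apply: eq_fps_mul.
Qed.

End FpsDivision.

(** * The generating function *)

Lemma numeratorE :
  'X^4 - 'X^3 - 3 *: 'X^2 + 3 *: 'X - 1 = Poly [:: -1; 3; -3; -1; 1] :> {poly rat}.
Proof. by rewrite /= !cons_poly_def -!mul_polyC; ring. Qed.

Lemma denominatorE : ('X^2 + 'X - 1) * (1 - 'X) ^+ 3 =
  Poly [:: -1; 4; -5; 1; 2; -1] :> {poly rat}.
Proof. by rewrite /= !cons_poly_def; ring. Qed.

(** The coefficients are those of the denominator, negative terms moved across: (1 - x)^3
    annihilates the quadratic part of the closed formula, x^2 + x - 1 the Fibonacci part. *)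
Lemma outer_words_recurrence n :
  (size (outer_words n.+4.+1) + 5 * size (outer_words n.+3) + size (outer_words n)
   = 4 * size (outer_words n.+4) + size (outer_words n.+2)
     + 2 * size (outer_words n.+1))%N.
Proof.
have := size_outer_words n; have := size_outer_words n.+1.
have := size_outer_words n.+2; have := size_outer_words n.+3.
have := size_outer_words n.+4; have := size_outer_words n.+4.+1.
rewrite (fibSS n.+4.+4) (fibSS n.+3.+4) (fibSS n.+2.+4) (fibSS n.+1.+4).
rewrite (binS n.+4.+1) (binS n.+4) (binS n.+3) (binS n.+2) (binS n.+1) !bin1; lia.
Qed.

Lemma convolution_denominator (a : nat -> nat) n :
  (a n.+4.+1 + 5 * a n.+3 + a n = 4 * a n.+4 + a n.+2 + 2 * a n.+1)%N ->
  \sum_(i < n.+4.+2) (a i)%:R * [:: -1; 4; -5; 1; 2; -1]`_(n.+4.+1 - i) = 0 :> rat.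
Proof.
(* The denominator has degree 5, so only the last six terms survive. *)
move=> rec_a; rewrite !big_ord_recr /= big1 => [|i _]; last first.
  by rewrite nth_default ?mulr0 //=; have := ltn_ord i; lia.
have d k : (n.+4.+1 - (k + n) = 5 - k)%N by lia.
rewrite (d 0%N) (d 1%N) (d 2%N) (d 3%N) (d 4%N) (d 5%N) /=.
have := congr1 (fun m : nat => m%:R : rat) rec_a; rewrite /= !natrD => rec_aR; lra.
Qed.

Theorem theorem4p10 :
  (forall n : nat, (1 <= n)%N ->
     #|avoiders n [:: p132; p4213; p2341]|%:Z =
     (fib (n + 5)%N)%:Z - 'C(n + 1, 2)%:Z - 2 * 'C(n + 1, 1)%:Z - 2) /\
  (fun n : nat => #|avoiders n [:: p132; p4213; p2341]|%:R : rat) =1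
  fps_div (fps_of_poly ('X^4 - 'X^3 - 3 *: 'X^2 + 3 *: 'X - 1))
          (fps_of_poly (('X^2 + 'X - 1) * (1 - 'X) ^+ 3)).
Proof.
split=> [n _|].
  have := size_outer_words n; rewrite card_avoiders addn1 bin1 !addnS !addn0; lia.
apply: fps_divP => [|n]; first by rewrite /fps_of_poly denominatorE coef_Poly.
rewrite /fps_mul /fps_of_poly numeratorE denominatorE.
under eq_bigr do rewrite card_avoiders.
under eq_bigr do rewrite coef_Poly.
rewrite coef_Poly.
(* The numerator has degree 4: coefficients 0 to 4 are computed, and from 5 on the product must
   vanish. *)
case: n => [|[|[|[|[|n]]]]].
- by rewrite !big_ord_recr big_ord0.
- by rewrite !big_ord_recr big_ord0.
- by rewrite !big_ord_recr big_ord0.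
- by rewrite !big_ord_recr big_ord0.
- by rewrite !big_ord_recr big_ord0.
rewrite [RHS]nth_default //.
apply: (@convolution_denominator (fun m => size (outer_words m))).
exact: outer_words_recurrence.
Qed.
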